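(* Let $\mathcal{S}=(S,r,\phi)$ be a stochastic binary system with component set $S=\{1,\dots,N\}$. Then $\mathcal{S}$ is separable if and only if there exist non-negative real numbers $n_1,\dots,n_N$ (costs of the components) such that $$\sum_{i=1}^N n_i < c(\sigma^* )+c(\omega^* ),$$ where $c(\sigma^* )=\min\{\sum_{i:\sigma_i=1} n_i : \sigma \text{ a pathset}\}$ is the minimum cost of a pathset and $c(\omega^* )=\min\{\sum_{i:\omega_i=0} n_i : \omega \text{ a cutset}\}$ is the minimum cost of a cutset.
   Context: A stochastic binary system (SBS) is a triple $\mathcal{S}=(S,r,\phi)$ where $S=\{1,\dots,N\}$ is a finite set of components, the set of states is $\Omega=\{0,1\}^N$, $r$ is a probability measure on $\Omega$, and $\phi:\Omega\to\{0,1\}$ is the structure function. A state $\sigma$ with $\phi(\sigma)=1$ is a pathset; a state $\omega$ with $\phi(\omega)=0$ is a cutset. The SBS is separable if there is a hyperplane separating pathsets from cutsets, where (following the paper's convention) the hyperplane is taken with non-negative normal vector: i.e. there exist $n_1,\dots,n_N\ge 0$ and $\alpha_0\in\mathbb{R}$ with $\sum_i n_i\sigma_i>\alpha_0$ for every pathset $\sigma$ and $\sum_i n_i\omega_i\le\alpha_0$ for every cutset $\omega$. The cost of a pathset is the sum of costs of its working components ($\sigma_i=1$); the cost of a cutset is the sum of costs of its failed components ($\omega_i=0$). A minimum over an empty set is taken to be $+\infty$. *)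

(* Defs.v *)
From HB Require Import structures.
From mathcomp Require Import all_boot all_order all_algebra.
From mathcomp Require Import all_classical all_reals all_analysis.

Set Implicit Arguments.
Unset Strict Implicit.
Unset Printing Implicit Defensive.

Import Order.TTheory GRing.Theory Num.Theory.
Local Open Scope ring_scope.

(* Component i + 1 of {1, ..., N} is represented by i : 'I_N, and
   [tnth x i = true] means that the component is working in state x. *)
Notation sbs_state N := (N.-tuple bool).

(* The product sigma-algebra on {0,1}^N is the full power set. *)
Lemma measurable_sbs_state (N : nat) (A : set (sbs_state N)) : measurable A.
Proof.
have m1 (x : sbs_state N) : measurable [set x]%classic.
  have -> : [set x]%classic = (\bigcap_(i in [set: 'I_N])
      ((@tnth N bool)^~ i @^-1` [set tnth x i]))%classic.
    by apply/seteqP; split=> [y -> //|y h]; apply: eq_from_tnth => i; exact: h.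
  apply: fin_bigcap_measurable => // i _.
  by rewrite -[X in measurable X]setTI; exact: measurable_tnth.
by rewrite -(image_id A) -bigcup_imset1; apply: fin_bigcup_measurable => //.
Qed.

Record sbs (R : realType) (N : nat) := SBS {
  sbs_prob : probability (sbs_state N) R ;
  structure_fun : sbs_state N -> bool
}.

Section SBSDefs.
Context {R : realType} {N : nat}.
Implicit Types (S : sbs R N) (n : 'I_N -> R) (x : sbs_state N).

Definition pathset S x : bool := structure_fun S x == true.
Definition cutset S x : bool := structure_fun S x == false.

(* The separating hyperplane is required to have a non-negative normal
   vector; the zero vector is not excluded. *)
Definition separable S : Prop :=
  exists n (alpha0 : R),
    [/\ forall i, 0 <= n i,
        forall x, pathset S x -> alpha0 < \sum_(i < N) n i * (tnth x i)%:R
      & forall x, cutset S x -> \sum_(i < N) n i * (tnth x i)%:R <= alpha0].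

Definition pathset_cost n x : R := \sum_(i < N | tnth x i) n i.
Definition cutset_cost n x : R := \sum_(i < N | ~~ tnth x i) n i.

(* Taken in the extended reals: the minimum over an empty set is +oo. *)
Definition min_pathset_cost S n : \bar R :=
  \big[mine/+oo%E]_(x : sbs_state N | pathset S x) (pathset_cost n x)%:E.
Definition min_cutset_cost S n : \bar R :=
  \big[mine/+oo%E]_(x : sbs_state N | cutset S x) (cutset_cost n x)%:E.

End SBSDefs.

(* Main.v *)
(* A state x splits the total cost T into the cost p(x) of its working
   components and the cost T - p(x) of its failed ones.  Hence
   T < c(sigma) + c(omega) says exactly p(omega) < p(sigma), and the hyperplane
   with normal n can be placed at the level max p(omega) over the cutsets, or at
   any negative level when there is none. *)
Require Import Defs.
From HB Require Import structures.
From mathcomp Require Import all_boot all_order all_algebra.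
From mathcomp Require Import all_classical all_reals all_analysis.
From mathcomp Require Import lra.

Set Implicit Arguments.
Unset Strict Implicit.
Unset Printing Implicit Defensive.

Import Order.TTheory GRing.Theory Num.Theory.
Local Open Scope ring_scope.

(** Serves to trade extended reals for real numbers: every term is finite, so [+oo] can only come
    from an empty index set. *)
Lemma bigmine_fin_case (R : realType) (I : finType) (P : pred I) (F : I -> R) :
  (P =1 xpred0 /\ \big[mine/+oo%E]_(i | P i) (F i)%:E = +oo%E) \/
  (exists2 i, P i & \big[mine/+oo%E]_(i | P i) (F i)%:E = (F i)%:E).
Proof.
have [i Pi|P0] := pickP P; last by left; split; rewrite ?big_pred0.
right; have [|j Pj ->] := eq_bigmin (x := +oo%E) i P (fun i => (F i)%:E) Pi.
  by move=> k _; rewrite leey.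
by exists j.
Qed.

Lemma pathset_costE (R : realType) (N : nat) (n : 'I_N -> R) (x : sbs_state N) :
  pathset_cost n x = \sum_(i < N) n i * (tnth x i)%:R.
Proof.
rewrite /pathset_cost big_mkcond /=; apply: eq_bigr => i _.
by case: (tnth x i); rewrite ?mulr1 ?mulr0.
Qed.

Lemma pathset_cost_ge0 (R : realType) (N : nat) (n : 'I_N -> R)
    (x : sbs_state N) :
  (forall i, 0 <= n i) -> 0 <= pathset_cost n x.
Proof. by move=> n0; apply: sumr_ge0. Qed.

Lemma cutset_costE (R : realType) (N : nat) (n : 'I_N -> R) (x : sbs_state N) :
  cutset_cost n x = \sum_(i < N) n i - pathset_cost n x.
Proof.
by rewrite (bigID (fun i => tnth x i)) /= -/(pathset_cost n x) addrC addrK.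
Qed.

Theorem theorem3 (R : realType) (N : nat) (S : sbs R N) :
  separable S <->
  exists n : 'I_N -> R,
    (forall i : 'I_N, 0 <= n i) /\
    ((\sum_(i < N) n i)%:E < min_pathset_cost S n + min_cutset_cost S n)%E.
Proof.
split=> [[n [a [n0 hp hc]]]|[n [n0 hT]]]; exists n.
  split=> //; rewrite /min_pathset_cost /min_cutset_cost.
  (* If either minimum is [+oo], so is the sum, which exceeds the finite total; only attained minima
     at [x] and [y] remain. *)
  have [[_ ->]|[x Px ->]] := bigmine_fin_case (pathset S) (pathset_cost n);
    have [[_ ->]|[y Py ->]] := bigmine_fin_case (cutset S) (cutset_cost n);
    rewrite ?addye ?addey ?ltry //.
  rewrite -EFinD lte_fin cutset_costE.
  have := hp _ Px; have := hc _ Py; rewrite -!pathset_costE; lra.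
have [[C0 _]|[y Py yE]] := bigmine_fin_case (cutset S) (cutset_cost n).
  exists (- 1); split=> // x; last by rewrite C0.
  by move=> _; rewrite -pathset_costE; have := pathset_cost_ge0 x n0; lra.
exists (pathset_cost n y); split=> // x Px; rewrite -pathset_costE.
  have : ((\sum_(i < N) n i)%:E < (pathset_cost n x)%:E + (cutset_cost n y)%:E)%E.
    (* An arbitrary pathset [x] costs at least the minimum, so no cheapest pathset has to be
       chosen. *)
    by apply: lt_le_trans hT _; rewrite /min_cutset_cost yE leeD2r // bigmin_le_cond.
  by rewrite -EFinD lte_fin cutset_costE; lra.
(* Least failed cost at [y] means greatest working cost among cutsets. *)
have : ((cutset_cost n y)%:E <= (cutset_cost n x)%:E)%E.
  by rewrite -yE bigmin_le_cond.
by rewrite lee_fin !cutset_costE; lra.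
Qed.
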